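(* For every real number $c>0$, there is a real number $d>0$ such that for every planar graph $H$ with at least two vertices, if $f(H)\le c\,|V(H)|$, then $H$ contains at most $\dfrac{d\,|V(H)|}{\log|V(H)|}$ vertex-disjoint cycles (that is, every collection of pairwise vertex-disjoint cycles in $H$ has at most this many members).
   Context: Graphs are finite and simple. For a planar graph $H$, $f(H)$ denotes the minimum integer such that every graph with no minor isomorphic to $H$ has treewidth at most $f(H)$ (it exists by a theorem of Robertson and Seymour). $\log$ is the natural logarithm. *)

(* Defs.v *)
From HB Require Import structures.
From mathcomp Require Import all_boot all_order all_algebra.
From mathcomp Require Import all_classical all_reals all_analysis.

Set Implicit Arguments.
Unset Strict Implicit.
Unset Printing Implicit Defensive.

Import Order.TTheory GRing.Theory Num.Theory.
Import numFieldNormedType.Exports.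

Local Open Scope ring_scope.

Record sgraph := SGraph {
  vertex :> finType;
  adj : rel vertex;
  adj_sym : symmetric adj;
  adj_irrefl : irreflexive adj
}.

(* A cycle is given by its cyclic sequence of vertices; rotating or reversing
   the sequence describes the same cycle on the same vertices. *)
Definition is_cycle (G : sgraph) (c : seq G) : bool :=
  [&& (2 < size c)%N, cycle (@adj G) c & uniq c].

(* Since cycles are nonempty, the members of such a list are distinct cycles,
   so that its size is the number of cycles in the collection. *)
Definition disjoint_cycles (G : sgraph) (cs : seq (seq G)) : bool :=
  all (@is_cycle G) cs && pairwise (fun c c' : seq G => [disjoint c & c']) cs.

Definition connected_in (G : sgraph) (A : {set G}) : Prop :=
  {in A &, forall x y,
    connect [rel u v | [&& u \in A, v \in A & adj u v]] x y}.

Definition is_tree (T : sgraph) : Prop :=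
  [/\ (0 < #|T|)%N, connected_in [set: T]%SET
    & forall c : seq T, ~~ is_cycle c].

(* [phi] assigns to each vertex of [H] its branch set, the set of vertices of
   [G] that is contracted to that vertex. *)
Definition has_minor (G H : sgraph) : Prop :=
  exists phi : H -> {set G},
    [/\ forall x, phi x != finset.set0 /\ connected_in (phi x),
        forall x y, x != y -> [disjoint phi x & phi y]
      & forall x y, adj x y ->
          exists u v, [/\ u \in phi x, v \in phi y & adj u v]].

Definition is_tree_decomposition (G T : sgraph) (B : T -> {set G}) : Prop :=
  [/\ is_tree T,
      forall v, exists t, v \in B t,
      forall u v, adj u v -> exists t, (u \in B t) && (v \in B t)
    & forall v, connected_in [set t | v \in B t]%SET].

(* The subtraction is truncated, so that the empty graph has treewidth 0
   instead of -1. *)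
Definition width (G T : sgraph) (B : T -> {set G}) : nat :=
  (\max_(t : T) #|B t|).-1.

Definition has_decomposition_of_width (G : sgraph) (k : nat) : Prop :=
  exists (T : sgraph) (B : T -> {set G}),
    is_tree_decomposition B /\ width B = k.

Lemma ex_decomposition (G : sgraph) :
  exists k, `[< has_decomposition_of_width G k >].
Proof.
have sym0 : symmetric (fun _ _ : unit => false) by [].
have irr0 : irreflexive (fun _ _ : unit => false) by [].
pose T := SGraph sym0 irr0.
pose B : T -> {set G} := fun=> [set: G]%SET.
exists (width B); apply/asboolP; exists T, B; split=> //; split.
- split=> [|[] [] _ _|[|[] [|[] [|[] c]]] //]; first by rewrite card_unit.
  exact: connect0.
- by move=> v; exists tt; rewrite inE.
- by move=> u v _; exists tt; rewrite !inE.
- by move=> v [] [] _ _; exact: connect0.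
Qed.

Definition treewidth (G : sgraph) : nat := ex_minn (ex_decomposition G).

Definition bounds_excluded_treewidth (H : sgraph) (k : nat) : Prop :=
  forall G : sgraph, ~ has_minor G H -> (treewidth G <= k)%N.

(* The graph of the function usually written f(H); f(H) exists exactly when
   [H] is planar (Robertson and Seymour). *)
Definition is_excluded_treewidth (H : sgraph) (k : nat) : Prop :=
  bounds_excluded_treewidth H k /\
  forall m, bounds_excluded_treewidth H m -> (k <= m)%N.

Local Open Scope classical_set_scope.

Definition is_arc (R : realType) (x y : R * R) (A : set (R * R)) : Prop :=
  exists g : R -> R * R,
    [/\ {within `[0, 1], continuous g}, {in `[0, 1] &, injective g},
        g 0 = x, g 1 = y & g @` `[0, 1] = A].

(* [p] places the vertices and [A] draws the edges, an edge being represented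
   by the set of its two endpoints. *)
Definition planar (R : realType) (G : sgraph) : Prop :=
  exists (p : G -> R * R) (A : {set G} -> set (R * R)),
    [/\ injective p,
        forall u v, adj u v -> is_arc (p u) (p v) (A [set u; v]%SET)
      & forall u v, adj u v ->
          let interior_uv := A [set u; v]%SET `\` [set p u; p v] in
          (forall w, ~ interior_uv (p w)) /\
          (forall x y, adj x y -> [set x; y]%SET != [set u; v]%SET ->
             interior_uv `&` A [set x; y]%SET = set0)].

(* Main.v *)
Require Import Defs.
From mathcomp Require Import all_boot all_order all_algebra.
From mathcomp Require Import boolp reals exp zify ring.

(** The bound holds because some sparse graphs have linear treewidth although
    almost all their cycles are long. Let [H] have [n] vertices and [k] disjoint
    cycles, and let [G] be a graph of treewidth larger than [c * n]. As [f(H)] is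
    at most [c * n], the graph [H] is a minor of [G]. The branch sets of the
    vertices of a cycle of [H] together contain a cycle of [G], so [G] has [k]
    disjoint cycles too ([minor_disjoint_cycles]). If [G] has only [O(n)] vertices
    and only [O(sqrt n)] cycles of length below a small multiple [M] of [log n],
    then [k = O(sqrt n) + O(n / M)], which is [O(n / log n)].

    Such a graph [G] on [N] vertices is found by counting. Choose [C * N] pairs
    of vertices at random. For a suitable constant [C], with high probability any
    two disjoint sets of at least [N / 4] vertices are joined by an edge
    ([card_edgeless]), while the expected number of cycles of length less than
    [M] is at most [(2 * C) ^ M] ([sum_short_cycles]). One outcome has both few
    short cycles and the expansion property ([exists_sparse_expander]).

    Expansion forces large treewidth ([expanding_treewidth]): in every tree
    decomposition some bag separates the graph into two sides, and if that bag
    were small, both sides would have at least a quarter of the vertices. *)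

Set Implicit Arguments.
Unset Strict Implicit.
Unset Printing Implicit Defensive.

Import Order.TTheory GRing.Theory Num.Theory.
Local Open Scope nat_scope.
Local Open Scope set_scope.

(** * Balanced separators from tree decompositions *)

(** The vertex [t] is the only gate between [X] and the rest of the tree.
    Hence every vertex of the decomposed graph whose bags meet both [X] and its
    complement lies in the bag at [t], which makes that bag a separator. *)
Definition tree_cut (T : sgraph) (X : {set T}) (t : T) : Prop :=
  t \in X /\ forall x y, x \in X -> y \notin X -> adj x y -> x = t.

(** Remove [t] from [X]. If what remains is disconnected, split off one of its
    components and keep [t] as the gate on both sides. If it is connected, then
    acyclicity leaves [t] at most one neighbour in it; that neighbour is the
    gate of the remainder, and the other piece is [t] alone. *)
Lemma tree_cut_split (T : sgraph) (X : {set T}) (t : T) :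
  (forall c : seq T, ~~ is_cycle c) -> tree_cut X t -> X != [set t] ->
  exists X1 t1 X2 t2, [/\ tree_cut X1 t1, tree_cut X2 t2,
    X = X1 :|: X2, #|X1| < #|X| & #|X2| < #|X|].
Proof.
move=> acyc [tX cutX] Xt.
have [s sXt] : exists s, s \in X :\ t.
  apply/set0Pn; apply: contraNneq Xt => Xt0.
  by rewrite -(setD1K tX) Xt0 setU0.
pose e := [rel u v | [&& u \in X :\ t, v \in X :\ t & adj u v]].
have e_sym : connect_sym e.
  by apply: sym_connect_sym => x y; rewrite /= adj_sym andbCA.
pose C := [set x | connect e s x].
have CX : C \subset X :\ t.
  apply/subsetP => x; rewrite inE => /connectP[p].
  elim/last_ind: p => [|p y _] /=; first by move=> _ ->.
  by rewrite rcons_path last_rcons => /andP[_ /and3P[_ ? _]] ->.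
have sC : s \in C by rewrite inE connect0.
have Cclosed x y : x \in C -> y \in X :\ t -> adj x y -> y \in C.
  move=> xC yX xy; have xX := subsetP CX _ xC.
  rewrite inE in xC; rewrite inE (connect_trans xC) // connect1 //=.
  by rewrite xX yX.
have [CE|CneqX] := eqVneq C (X :\ t); last first.
  (* disconnected remainder: the pieces are t |: C and X :\: C *)
  have CtX : t |: C \proper X.
    rewrite properEneq subUset sub1set tX (subset_trans CX (subD1set _ _)).
    rewrite !andbT; apply: contraNneq CneqX => <-.
    by rewrite setU1K //; apply/negP => /(subsetP CX); rewrite !inE eqxx.
  have XsC : X :\: C \proper X.
    rewrite properEneq subsetDl andbT; apply/eqP => /setP/(_ s).
    by rewrite in_setD sC (subsetP (subD1set X t)) ?(subsetP CX).
  have tC : t \notin C by apply/negP => /(subsetP CX); rewrite !inE eqxx.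
  exists (t |: C), t, (X :\: C), t; split; last 2 first.
  - exact: proper_card.
  - exact: proper_card.
  - split; first by rewrite !inE eqxx.
    move=> x y /setU1P[//|xC]; rewrite !inE negb_or => /andP[yt yC] xy.
    have xXt := subsetP CX _ xC.
    have [yX|yX] := boolP (y \in X).
      by have := Cclosed x y xC; rewrite !inE yt yX (negbTE yC) => /(_ isT xy).
    by apply: (cutX x y) => //; move: xXt; rewrite !inE => /andP[].
  - split; first by rewrite in_setD tC.
    move=> x y /setDP[xX xC] yXC xy; apply/eqP; apply: contraNT xC => xt.
    have [yX|yX] := boolP (y \in X); last by rewrite (cutX x y) ?eqxx in xt.
    apply: (Cclosed y x); first by move: yXC; rewrite in_setD yX andbT negbK.
      by rewrite in_setD1 xt.
    by rewrite adj_sym.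
  - apply/setP => x; rewrite in_setU in_setD in_setU in_set1.
    have [->|xt /=] := eqVneq x t; first by rewrite tX.
    have [xC|xC] //= := boolP (x \in C); rewrite ?orbF //.
    by have := subsetP CX _ xC; rewrite !inE => /andP[].
(* two neighbours of t joined by a path avoiding t would close a cycle *)
have one_nbr x y : x \in C -> y \in C -> adj t x -> adj t y -> x = y.
  move=> xC yC tx ty; apply/eqP/negP => /negP xy.
  have : connect e x y.
    rewrite inE in xC; rewrite inE in yC.
    by apply: connect_trans yC; rewrite e_sym.
  case/connectP => p0 ep0 yE0; case/shortenP: ep0 yE0 => p ep Up _ yE.
  have pX : all (mem (X :\ t)) (x :: p).
    have := subsetP CX _ xC => xX; rewrite /= xX /=.
    elim: p x ep {Up yE xC tx xy xX} => //= z p IHp x /andP[/and3P[_ -> _]].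
    exact: IHp.
  apply: (negP (acyc (t :: x :: p))); apply/and3P; split.
  - by case: p yE {ep Up pX} => // yE; rewrite yE eqxx in xy.
  - rewrite /= rcons_path -yE tx [adj y t]adj_sym ty andbT /=.
    by apply: sub_path ep => u v /and3P[].
  - by rewrite cons_uniq Up andbT; apply/negP => /(allP pX); rewrite !inE eqxx.
(* with no neighbour of t in C, nothing leaves C and any vertex is a gate *)
have [t' t'C t'P] : exists2 t', t' \in C &
    forall x, x \in C -> adj t x -> x = t'.
  have [[t' t'C tt']|none] := pselect (exists2 t', t' \in C & adj t t').
    by exists t' => // x xC tx; apply: one_nbr.
  by exists s => // x xC tx; case: none; exists x.
exists C, t', [set t], t; split.
- split=> // x y xC yC xy.
  have /setD1P[xt xX] := subsetP CX _ xC.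
  have [yt|yt] := eqVneq y t; first by apply: t'P => //; rewrite -yt adj_sym.
  by move: yC; rewrite CE !inE yt /= => /cutX/(_ xy) xt'; rewrite xt' ?eqxx in xt.
- by split=> [|x y]; rewrite ?inE // => /eqP.
- by rewrite CE setUC setD1K.
- by rewrite CE [X in _ < X](cardsD1 t) tX.
- by rewrite cards1 (cardsD1 t) tX CE in sC *; rewrite ltnS card_gt0; apply/set0Pn; exists s.
Qed.

Definition expanding (G : sgraph) : Prop :=
  forall A B : {set G}, [disjoint A & B] ->
    #|G| <= 4 * #|A| -> #|G| <= 4 * #|B| ->
    exists u v, [/\ u \in A, v \in B & adj u v].

(** The nodes whose bags contain [u] form a connected set that meets [X] and
    misses [t], so it cannot leave [X]. A bag containing both ends of an edge
    at [u] is therefore indexed by [X]. *)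
Lemma tree_cut_separates (G T : sgraph) (B : T -> {set G}) X t u v :
  is_tree_decomposition B -> tree_cut X t ->
  u \in \bigcup_(s in X) B s -> u \notin B t ->
  v \notin \bigcup_(s in X) B s -> ~~ adj u v.
Proof.
case=> _ _ edge conn [tX cutX] /bigcupP[s sX us] ut vX.
apply/negP => /edge[r /andP[ur vr]].
have {vX} rX : r \notin X.
  by apply: contra vX => rX; apply/bigcupP; exists r.
have := conn u s r; rewrite !inE us ur => /(_ isT isT) /connectP[p].
elim: p s sX us => [|y p IHp] s sX us /=; first by move=> _ rs; rewrite rs sX in rX.
case/andP => /and3P[]; rewrite !inE => _ uy sy; apply: IHp => //.
by apply: contraR ut => yX; rewrite -(cutX s y).
Qed.

(** Starting from the whole tree, keep splitting cuts and moving to a piece whose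
    bags still cover a third of the graph, until they cover less than two
    thirds. If all bags had at most a twelfth of the vertices, then removing the
    bag at the gate would leave two sides of at least a quarter each with no
    edge between them. *)
Lemma expanding_treewidth (G : sgraph) :
  expanding G -> #|G| <= 12 * (treewidth G).+1.
Proof.
move=> expG; rewrite /treewidth; case: ex_minnP => k /asboolP[T [B [decB <-]]] _.
set K := (width B).+1; have bagK t : #|B t| <= K.
  exact: leq_trans (leq_bigmax (F := fun s => #|B s|) t) (leqSpred _).
rewrite leqNgt; apply/negP => small.
have [[/card_gt0P[t0 _] _ acyc] cover _ _] := decB.
pose W (X : {set T}) := \bigcup_(s in X) B s.
have balanced n (X : {set T}) t : #|X| < n -> tree_cut X t ->
    #|G| <= 3 * #|W X| ->
    exists Y s, [/\ tree_cut Y s, #|G| <= 3 * #|W Y| & 3 * #|W Y| < 2 * #|G|].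
  elim: n X t => // n IHn X t Xn cutX bigX.
  have [lt|ge] := ltnP (3 * #|W X|) (2 * #|G|); first by exists X, t.
  have [Xt|Xt] := eqVneq X [set t].
    have := bagK t; rewrite /W Xt big_set1 in ge; lia.
  have [X1 [t1 [X2 [t2 [cut1 cut2 XE lt1 lt2]]]]] := tree_cut_split acyc cutX Xt.
  have WE : W X = W X1 :|: W X2.
    by rewrite /W XE; apply: bigcup_setU.
  have := cardsU (W X1) (W X2); rewrite -WE => WU.
  have [big1|small1] := leqP #|G| (3 * #|W X1|).
    by apply: (IHn X1 t1) => //; lia.
  by apply: (IHn X2 t2) => //; lia.
have cutT : tree_cut [set: T] t0 by split=> // x y _; rewrite !inE.
have WT : W [set: T] = [set: G].
  by apply/setP => v; rewrite inE; have [t vt] := cover v; apply/bigcupP; exists t.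
have [|Y [s [cutY lo hi]]] := balanced _ _ _ (ltnSn _) cutT.
  by rewrite WT cardsT; lia.
have := cardsD (W Y) (B s); have := cardsC (W Y).
have := subset_leq_card (subsetIr (W Y) (B s)); have := bagK s => h1 h2 h3 h4.
have [||| u [v [uW vW]]] := expG (W Y :\: B s) (~: W Y).
- by rewrite -setI_eq0; apply/eqP/setP => x; rewrite !inE; case: (x \in W Y); rewrite ?andbF.
- lia.
- lia.
move: uW vW; rewrite !inE => /andP[us uW] vW.
exact: (negP (tree_cut_separates decB cutY uW us vW)).
Qed.

(** * Disjoint cycles and minors *)

Lemma disjoint_cycles_uniq (G : sgraph) (cs : seq (seq G)) :
  disjoint_cycles cs -> uniq (flatten cs).
Proof.
rewrite /disjoint_cycles; elim: cs => //= c cs IHcs.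
case/andP => /andP[/and3P[_ _ Uc] cycs] /andP[dis dcs].
rewrite cat_uniq Uc IHcs ?cycs ?dcs // andbT.
apply/hasPn => x /flattenP[d dcs' xd]; apply/negP => xc.
by have /disjointFr/(_ xc) := allP dis _ dcs'; rewrite xd.
Qed.

(** An edge whose ends stay connected after its deletion lies on a cycle: close
    up a simple path between the ends. *)
Lemma cycle_in_connect (G : sgraph) (U : {set G}) (u v : G) :
  u \in U -> v \in U -> adj u v ->
  connect [rel x y | [&& x \in U, y \in U, adj x y &
                         [set x; y] != [set u; v]]] v u ->
  exists2 c, is_cycle c & {subset c <= U}.
Proof.
move=> uU vU uv /connectP[p0 ep0 uE0]; case/shortenP: ep0 uE0 => p ep Up _ uE.
have pU : {subset v :: p <= U}.
    apply/allP; rewrite /= vU /=; elim: p {-1}v ep {Up uE} => //= z p IHp x.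
    by case/andP => /and4P[_ zU _ _] /IHp; rewrite zU.
exists (v :: p) => //; apply/and3P; split=> //.
- case: p => [|z [|z' p]] //= in ep Up uE pU *.
    by rewrite uE adj_irrefl in uv.
  by rewrite uE setUC eqxx !andbF in ep.
- rewrite /= rcons_path -uE uv andbT.
  by apply: sub_path ep => x y /and4P[].
Qed.

(** Let [a b] be an edge of the cycle [c] and [u v] an edge of [G] that realises
    it. The other edges of [c] and the connected branch sets lead from [v] back
    to [u] without using [u v], since the branch sets are disjoint. *)
Lemma minor_cycle (G H : sgraph) (phi : H -> {set G}) (c : seq H) :
  (forall x, phi x != set0 /\ connected_in (phi x)) ->
  (forall x y, x != y -> [disjoint phi x & phi y]) ->
  (forall x y, adj x y -> exists u v, [/\ u \in phi x, v \in phi y & adj u v]) ->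
  is_cycle c ->
  exists2 c', is_cycle c' & {subset c' <= \bigcup_(x in c) phi x}.
Proof.
move=> conn dis edge /and3P[szc cyc Uc].
case: c => [|a [|b [|x0 c]]] //= in szc cyc Uc *.
set cc := [:: a, b, x0 & c]; set U := \bigcup_(x in cc) phi x.
have phi_inj x y u : u \in phi x -> u \in phi y -> x = y.
  move=> ux uy; apply/eqP/negP => /negP /dis /disjointFr /(_ ux).
  by rewrite uy.
have /andP[ab cyc'] := cyc.
have [u [v [ua vb uv]]] := edge a b ab.
have phiU x : x \in cc -> phi x \subset U by move=> xc; apply: bigcup_sup.
have uU : u \in U by apply: subsetP ua; apply: phiU; rewrite !inE eqxx.
have vU : v \in U by apply: subsetP vb; apply: phiU; rewrite !inE eqxx orbT.
apply: (cycle_in_connect uU vU uv); set e := [rel x y | _].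
have ab' : a != b by apply: contraTneq ab => ->; rewrite adj_irrefl.
(* an edge inside one branch set cannot have its ends in two of them *)
have inner x s t : x \in cc -> s \in phi x -> t \in phi x -> connect e s t.
  move=> xc sx tx; have [_ /(_ s t sx tx)] := conn x.
  apply: connect_sub => p q /and3P[px qx pq]; apply: connect1.
  rewrite /= (subsetP (phiU _ xc)) ?(subsetP (phiU _ xc) q) ?pq //=.
  apply: contra ab' => /eqP pquv.
  have : u \in [set p; q] by rewrite pquv !inE eqxx.
  have : v \in [set p; q] by rewrite pquv !inE eqxx orbT.
  have phix w : w \in [set p; q] -> w \in phi x by case/set2P => ->.
  by move=> /phix vx /phix ux; rewrite (phi_inj _ _ _ ua ux) (phi_inj _ _ _ vb vx).
pose r := [rel x y | [&& x \in cc, y \in cc, adj x y &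
                         [set x; y] != [set a; b]]].
(* [set s'; t'] = [set u; v] would force [set x; y] = [set a; b] *)
have outer p x s t : path r x p -> x \in cc ->
    s \in phi x -> t \in phi (last x p) -> connect e s t.
  elim: p x s => [|y p IHp] x s /=; first by move=> _; apply: inner.
  case/andP => /and4P[_ yc xy xyab] py xc sx tp.
  have [s' [t' [sx' ty st]]] := edge x y xy.
  apply: connect_trans (inner x s s' xc sx sx') _.
  apply: connect_trans (IHp y t' py yc ty tp); apply: connect1.
  rewrite /= (subsetP (phiU _ xc)) // (subsetP (phiU _ yc)) // st /=.
  apply: contra xyab => /eqP stuv.
  have sub w : w \in [set s'; t'] -> exists2 z, z \in [set x; y] & w \in phi z.
    by case/set2P => ->; [exists x | exists y]; rewrite ?inE ?eqxx ?orbT.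
  have [|z1 z1xy uz1] := sub u; first by rewrite stuv !inE eqxx.
  have [|z2 z2xy vz2] := sub v; first by rewrite stuv !inE eqxx orbT.
  rewrite (phi_inj _ _ _ ua uz1) (phi_inj _ _ _ vb vz2) in ab' *.
  rewrite eqEsubset !subUset !sub1set.
  move: z1xy z2xy ab'; rewrite !inE.
  by do 2![case/orP => /eqP->]; rewrite ?eqxx ?orbT.
have last_a : a = last b (x0 :: rcons c a) by rewrite /= last_rcons.
apply: (outer (x0 :: rcons c a) b) => //; last by rewrite -last_a.
  have : all (mem cc) (x0 :: rcons c a).
    by apply/allP => x; rewrite inE mem_rcons !inE => /or3P[] ->; rewrite ?orbT.
  have : all [pred x | (x != a) && (x != b)] (x0 :: c).
    apply/allP => x xc /=; move: Uc => /and3P[]; rewrite inE negb_or.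
    case/andP => _ ac bc _; apply/andP; split.
      by apply: contraNneq ac => <-.
    by apply: contraNneq bc => <-.
  case/andP: cyc' => bx0 x0c /= /andP[/andP[x0a x0b] cab] /andP[x0cc ccc].
  have new x y : x != a -> x != b -> [set x; y] != [set a; b].
    move=> xa xb; apply/eqP => /setP/(_ x).
    by rewrite !inE eqxx (negbTE xa) (negbTE xb).
  have bcc : b \in cc by rewrite !inE eqxx orbT.
  rewrite setUC new // bx0 x0cc bcc /=.
  have tail q x : x != a -> x != b -> x \in cc ->
      path (@adj H) x (rcons q a) -> all [pred y | (y != a) && (y != b)] q ->
      all (mem cc) (rcons q a) -> path r x (rcons q a).
    elim: q x => [|y q IHq] x xa xb xcc /=.
      by rewrite !andbT => -> _ ->; rewrite xcc new.
    case/andP=> xy yq /andP[/andP[ya yb] qab] /andP[ycc qcc].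
    by rewrite xy ycc xcc new // IHq.
  exact: tail.
by rewrite !inE eqxx orbT.
Qed.

Lemma minor_disjoint_cycles (G H : sgraph) (cs : seq (seq H)) :
  has_minor G H -> disjoint_cycles cs ->
  exists2 cs' : seq (seq G), disjoint_cycles cs' & size cs' = size cs.
Proof.
case=> phi [conn dis edge] /andP[cycs dcs].
have /choice[g gP] : forall c : seq H, exists c' : seq G, is_cycle c ->
    is_cycle c' /\ {subset c' <= \bigcup_(x in c) phi x}.
  move=> c; have [cc|] := boolP (is_cycle c); last by exists [::].
  by have [c' ? ?] := minor_cycle conn dis edge cc; exists c'.
exists (map g cs); last by rewrite size_map.
apply/andP; split; first by rewrite all_map; apply: sub_all cycs => c /gP[].
rewrite pairwise_map; apply: (sub_in_pairwise (P := @is_cycle H)) dcs => //.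
move=> c d /gP[_ gc] /gP[_ gd] cd /=.
rewrite -[X in is_true X]negbK; apply/negP => /pred0Pn[v /andP[/= /gc vc /gd vd]].
case/bigcupP: vc => x xc vx; case/bigcupP: vd => y yd vy.
have xy : x != y by apply: contraTneq yd => <-; rewrite (disjointFr cd).
by have := disjointFr (dis _ _ xy) vx; rewrite vy.
Qed.

(** * Counting random graphs *)

Lemma card_exists_le (I T : finType) (Q : I -> pred T) :
  #|[set x | [exists i, Q i x]]| <= \sum_i #|[set x | Q i x]|.
Proof.
have -> : [set x | [exists i, Q i x]] = \bigcup_i [set x | Q i x].
  apply/setP => x; rewrite inE; apply/existsP/bigcupP => [[i Qi]|[i _]].
    by exists i; rewrite ?inE.
  by rewrite inE; exists i.
elim/big_rec2: _ => [|i n A _ IH]; first by rewrite cards0.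
by rewrite cardsU (leq_trans (leq_subr _ _)) // leq_add2l.
Qed.

(** With the values of [f] chosen independently and uniformly, this says that
    the probability of [#|J|] constraints on distinct arguments is at most
    [(e / #|T|) ^ #|J|]; the denominators are cleared. *)
Lemma card_ffun_prescribed (I J T : finType) (tau : J -> I) (E : J -> {set T}) e :
  injective tau -> (forall j, #|E j| <= e) ->
  #|[set f : {ffun I -> T} | [forall j, f (tau j) \in E j]]| * #|T| ^ #|J|
    <= e ^ #|J| * #|T| ^ #|I|.
Proof.
move=> tau_inj Ee.
pose F i := if [pick j | tau j == i] is Some j then mem (E j) else mem [set: T].
have Ftau j : F (tau j) = mem (E j).
  rewrite /F; case: pickP => [k /eqP/tau_inj->|/(_ j)] //.
  by rewrite eqxx.
set A := [set f | _].
have AF : #|A| <= #|family F|.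
  apply/subset_leq_card/subsetP => f; rewrite inE => /forallP Af.
  apply/familyP => i; rewrite /F; case: pickP => [j /eqP <-|_]; first exact: Af.
  by rewrite inE.
apply: (leq_trans (leq_mul AF (leqnn _))); rewrite card_family foldrE big_map.
rewrite -(card_imset _ tau_inj) big_enum /=.
rewrite (bigID (mem (tau @: J))) /= -mulnA leq_mul //.
  rewrite big_imset /=; last by move=> ? ? _ _; apply: tau_inj.
  rewrite (card_imset _ tau_inj) -prod_nat_const leq_prod // => j _.
  by rewrite Ftau; apply: leq_trans (Ee j); apply: eq_leq; apply: eq_card.
rewrite -[X in _ <= _ ^ X](cardC (tau @: J)) expnD mulnC leq_mul2l.
apply/orP; right; rewrite -prod_nat_const; apply: leq_prod => i _.
exact: max_card.
Qed.

Lemma leq_exp2rW a b e : a <= b -> a ^ e <= b ^ e.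
Proof. by case: e => // e ab; rewrite leq_exp2r. Qed.

(** The random graph is obtained from [m] independent uniform ordered pairs of
    vertices, with loops, orientations and repetitions forgotten. Probabilities
    thus become cardinals of sets of functions, the total being
    [(N * N) ^ m]. *)
Definition random_adj (N m : nat) (f : {ffun 'I_m -> 'I_N * 'I_N}) : rel 'I_N :=
  fun u v => (u != v) && [exists i, (f i == (u, v)) || (f i == (v, u))].

Lemma random_adj_sym (N m : nat) (f : {ffun 'I_m -> 'I_N * 'I_N}) :
  symmetric (random_adj f).
Proof.
move=> u v; rewrite /random_adj eq_sym; congr (_ && _).
by apply: eq_existsb => i; rewrite orbC.
Qed.

Lemma random_adj_irrefl (N m : nat) (f : {ffun 'I_m -> 'I_N * 'I_N}) :
  irreflexive (random_adj f).
Proof. by move=> u; rewrite /random_adj eqxx. Qed.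

Definition random_graph (N m : nat) (f : {ffun 'I_m -> 'I_N * 'I_N}) : sgraph :=
  SGraph (random_adj_sym f) (random_adj_irrefl f).

Definition edgeless_pair (N m : nat) (f : {ffun 'I_m -> 'I_N * 'I_N})
    (A B : {set 'I_N}) : bool :=
  [&& N <= 4 * #|A|, N <= 4 * #|B| & [forall i, f i \notin setX A B]].

(** At least a sixteenth of all pairs of vertices lie in [setX A B], and each of
    the [m] independent pairs has to avoid it. *)
Lemma card_edgeless_pair (N m : nat) (A B : {set 'I_N}) :
  #|[set f : {ffun 'I_m -> 'I_N * 'I_N} | edgeless_pair f A B]| * 16 ^ m
    <= 15 ^ m * (N * N) ^ m.
Proof.
have [big|small] := boolP ((N <= 4 * #|A|) && (N <= 4 * #|B|)); last first.
  rewrite (_ : [set f | _] = set0) ?cards0 //.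
  by apply/setP => f; rewrite !inE /edgeless_pair andbA (negbTE small).
have /subset_leq_card sub :
    [set f : {ffun 'I_m -> 'I_N * 'I_N} | edgeless_pair f A B]
      \subset ffun_on (mem (~: setX A B)).
  apply/subsetP => f; rewrite inE => /and3P[_ _ /forallP fAB].
  by apply/ffun_onP => i; rewrite inE.
apply: (leq_trans (leq_mul sub (leqnn _))).
rewrite card_ffun_on card_ord -!expnMn; apply: leq_exp2rW.
case/andP: big => bigA bigB; have := cardsC (setX A B).
rewrite cardsX card_prod card_ord; have := leq_mul bigA bigB.
rewrite mulnACA [#|mem _|](eq_card (B := ~: setX A B)) //; lia.
Qed.

(** Union bound: there are [4 ^ N] pairs of sets, each edgeless with probability
    at most [(15 / 16) ^ m <= 16 ^- N], so an edgeless pair exists with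
    probability at most [4 ^- N]. *)
Lemma card_edgeless (N m C : nat) : m = C * N -> 16 * 15 ^ C <= 16 ^ C ->
  #|[set f : {ffun 'I_m -> 'I_N * 'I_N} |
      [exists A, exists B, edgeless_pair f A B]]| * 4 ^ N <= (N * N) ^ m.
Proof.
move=> mE gapC.
pose Q (p : {set 'I_N} * {set 'I_N}) (f : {ffun 'I_m -> 'I_N * 'I_N}) :=
  edgeless_pair f p.1 p.2.
set S := [set f | _]; have SQ : #|S| <= \sum_p #|[set f | Q p f]|.
  apply: leq_trans (card_exists_le Q); apply/subset_leq_card/subsetP => f.
  rewrite !inE => /existsP[A /existsP[B fAB]].
  by apply/existsP; exists (A, B).
have : #|S| * 16 ^ m <= 4 ^ N * (15 ^ m * (N * N) ^ m).
  apply: (leq_trans (leq_mul SQ (leqnn _))); rewrite big_distrl /=.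
  have -> : 4 ^ N = #|{: {set 'I_N} * {set 'I_N}}|.
    have card_setT : #|{: {set 'I_N}}| = 2 ^ N.
      by rewrite -cardsT -powersetT card_powerset cardsT card_ord.
    by rewrite card_prod !card_setT -expnMn.
  by rewrite -sum_nat_const; apply: leq_sum => -[A B] _; apply: card_edgeless_pair.
have : 16 ^ N * 15 ^ m <= 16 ^ m.
  by rewrite mE !expnM -expnMn; apply: leq_exp2rW.
have b0 : 0 < 16 ^ m by rewrite expn_gt0.
move: b0; rewrite [16 ^ N](_ : _ = 4 ^ N * 4 ^ N); last by rewrite -expnMn.
move: (4 ^ N) (16 ^ m) (15 ^ m) ((N * N) ^ m) => a b d T b0 H1 H2.
rewrite -(@leq_pmul2l b) //.
apply: leq_trans (leq_mul H1 (leqnn T)).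
by have := leq_mul (leqnn a) H2; congr (_ <= _); ring.
Qed.

Lemma next_next_neq (T : eqType) (c : seq T) x :
  uniq c -> 2 < size c -> x \in c -> next c (next c x) != x.
Proof.
move=> Uc szc xc; have [i c' cE] := rot_to xc.
rewrite -2!(next_rot i Uc) cE; move: Uc szc; rewrite -(rot_uniq i) -(size_rot i) cE.
case: c' {cE} => [|y [|z c']] //= /and3P[]; rewrite !inE !negb_or => /and3P[xy xz _].
by rewrite eqxx [y == x]eq_sym (negbTE xy) eqxx [z == x]eq_sym xz.
Qed.

(** Every edge [x, next c x] of the cycle must be produced by some index, which
    leaves [m ^ l] choices of indices; for each choice the required edge and its
    reverse are the 2 admissible values. As [c] has more than two vertices, its
    edges are distinct as unordered pairs, so the chosen indices are distinct
    and their values independent. *)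
Lemma card_is_cycle (N m l : nat) (c : l.-tuple 'I_N) :
  #|[set f : {ffun 'I_m -> 'I_N * 'I_N} |
      @is_cycle (random_graph f) c]| * (N * N) ^ l
    <= m ^ l * 2 ^ l * (N * N) ^ m.
Proof.
pose edges (j : 'I_l) : {set 'I_N * 'I_N} :=
  let x := tnth c j in [set (x, next c x); (next c x, x)].
pose Q (tau : {ffun 'I_l -> 'I_m}) (f : {ffun 'I_m -> 'I_N * 'I_N}) :=
  injectiveb tau && [forall j, f (tau j) \in edges j].
have sub : [set f : {ffun 'I_m -> 'I_N * 'I_N} | @is_cycle (random_graph f) c]
    \subset [set f | [exists tau, Q tau f]].
  apply/subsetP => f; rewrite !inE => /and3P[szc cyc Uc].
  have /choice[tau tauP] : forall j, exists i, f i \in edges j.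
    move=> j; have := next_cycle cyc (mem_tnth j c).
    by case/andP => _ /existsP[i fi]; exists i; rewrite !inE.
  apply/existsP; exists (finfun tau); apply/andP; split; last first.
    by apply/forallP => j; rewrite ffunE.
  apply/injectiveP => j k; rewrite !ffunE => tjk.
  have := tauP j; have := tauP k; rewrite -tjk /edges.
  have no_swap a b : a \in c -> b = next c a -> next c b = a -> False.
    by move=> ac -> /eqP; rewrite (negbTE (next_next_neq Uc szc ac)).
  have tnth_inj := tuple_uniqP _ Uc.
  move: (f _) => p /set2P[] -> /set2P[] [].
  - by move=> /tnth_inj.
  - by move=> kj jk; case: (no_swap _ _ (mem_tnth j c) kj jk).
  - by move=> kj jk; case: (no_swap _ _ (mem_tnth j c) jk kj).
  - by move=> _ /tnth_inj.
apply: (leq_trans (leq_mul (subset_leq_card sub) (leqnn _))).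
apply: (leq_trans (leq_mul (card_exists_le Q) (leqnn _))).
rewrite big_distrl /=.
have -> : m ^ l * 2 ^ l * (N * N) ^ m =
    \sum_(tau : {ffun 'I_l -> 'I_m}) 2 ^ l * (N * N) ^ m.
  by rewrite sum_nat_const card_ffun !card_ord mulnA.
apply: leq_sum => tau _; rewrite /Q.
case: (boolP (injectiveb tau)) => [/injectiveP tau_inj|_] /=; last first.
  by rewrite (_ : [set f | _] = set0) ?cards0 //; apply/setP => f; rewrite !inE.
have := card_ffun_prescribed (E := edges) tau_inj.
rewrite card_prod !card_ord; apply => j.
by rewrite cards2; case: eqP.
Qed.

(** The value is [C = 60]: Bernoulli's inequality gives
    [2 * 15 ^ 15 <= 16 ^ 15], and the fourth power of this is what is needed.
    Hiding the value keeps these powers from being computed. *)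
Lemma exists_gap_exponent : exists C, 16 * 15 ^ C <= 16 ^ C.
Proof.
have bernoulli x n : x ^ n * (x + n) <= x * x.+1 ^ n.
  elim: n => [|n IHn]; first by rewrite !expn0; lia.
  by rewrite !expnS; have := leq_mul (leqnn x.+1) IHn; nia.
have double x : 0 < x -> 2 * x ^ x <= x.+1 ^ x.
  by move=> x0; rewrite -(leq_pmul2l x0); have := bernoulli x x; lia.
(* x and e stay variables so that conversion never meets the numeral 15 ^ 60 *)
have power x e : 0 < x -> e = 2 ^ 4 -> e * x ^ (x * 4) <= x.+1 ^ (x * 4).
  by move=> x0 ->; rewrite !expnM -expnMn; apply/leq_exp2rW/double.
by exists (15 * 4); apply: power.
Qed.

Lemma sum_expn_le q M : 1 < q -> \sum_(l < M) q ^ l <= q ^ M.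
Proof.
move=> q1; elim: M => [|M IHM]; first by rewrite big_ord0.
rewrite big_ord_recr expnS /=; apply: leq_trans (leq_mul q1 (leqnn _)).
by rewrite mul2n -addnn leq_add2r.
Qed.

Definition short_cycles (N m M : nat) (f : {ffun 'I_m -> 'I_N * 'I_N}) : nat :=
  \sum_(l < M) #|[set c : l.-tuple 'I_N | @is_cycle (random_graph f) c]|.

(** The expected number of cyclic sequences of length [l] is at most
    [(2 * C) ^ l]: there are [N ^ l] sequences of vertices, and each is a cycle
    with probability at most [(C * N) ^ l * 2 ^ l / (N * N) ^ l]. *)
Lemma sum_short_cycles N C M : 0 < N -> 0 < C ->
  \sum_f @short_cycles N (C * N) M f <= (2 * C) ^ M * (N * N) ^ (C * N).
Proof.
move=> N0 C0; have q1 : 1 < 2 * C by lia.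
apply: leq_trans (leq_mul (sum_expn_le M q1) (leqnn _)).
rewrite exchange_big big_distrl /=; apply: leq_sum => l _.
have NN0 : 0 < (N * N) ^ l by rewrite expn_gt0 muln_gt0 N0.
rewrite -(leq_pmul2r NN0).
under eq_bigr do rewrite -sum1_card (eq_bigl _ _ (fun c => in_set _ c)) big_mkcond.
rewrite exchange_big big_distrl /=.
apply: leq_trans (_ : \sum_(c : l.-tuple 'I_N)
    (C * N) ^ l * 2 ^ l * (N * N) ^ (C * N) <= _).
  apply: leq_sum => c _; apply: leq_trans (card_is_cycle _ c).
  rewrite -big_mkcond /= -sum1_card; apply: eq_leq; congr (_ * _).
  by apply: eq_bigl => f; rewrite inE.
rewrite sum_nat_const card_tuple card_ord !expnMn; apply: eq_leq; ring.
Qed.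

(** First moment method: charge [2 * (2 * C) ^ M] for the presence of an
    edgeless pair and 1 for every short cycle. Since edgeless pairs occur with
    probability at most 1/4, the expected charge is at most
    [3 / 2 * (2 * C) ^ M], so some outcome is charged less than
    [2 * (2 * C) ^ M]. *)
Lemma exists_sparse_expander C N M : 16 * 15 ^ C <= 16 ^ C -> 0 < N ->
  exists f : {ffun 'I_(C * N) -> 'I_N * 'I_N},
    (forall A B, ~~ edgeless_pair f A B) /\ short_cycles M f < 2 * (2 * C) ^ M.
Proof.
move=> gapC N0; have C0 : 0 < C by case: C gapC.
apply: contrapT => none.
have := sum_short_cycles M N0 C0; have := card_edgeless (erefl (C * N)) gapC.
set S := [set f | _]; set T := (N * N) ^ _; set b := (2 * C) ^ M => ST sumT.
have b0 : 0 < b by rewrite expn_gt0 muln_gt0 C0.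
have T0 : 0 < T by rewrite expn_gt0 muln_gt0 N0.
have N4 : 4 <= 4 ^ N by rewrite -[X in X <= _]expn1 leq_exp2l.
have {ST} S4 : #|S| * 4 <= T by apply: leq_trans ST; rewrite leq_mul.
have : \sum_(f : {ffun 'I_(C * N) -> 'I_N * 'I_N}) 2 * b
    <= \sum_f (short_cycles M f + (f \in S) * (2 * b)).
  apply: leq_sum => f _; rewrite inE; case: existsP => [_|noAB] /=.
    by rewrite mul1n leq_addl.
  rewrite mul0n addn0 leqNgt; apply/negP => fb; apply: none; exists f; split=> // A B.
  by apply/negP => fAB; apply: noAB; exists A; apply/existsP; exists B.
have sumS : \sum_f (f \in S) * (2 * b) = #|S| * (2 * b).
  rewrite -sum1_card big_distrl [RHS]big_mkcond /=; apply: eq_bigr => f _.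
  by case: (f \in S).
rewrite sum_nat_const big_split sumS card_ffun card_prod !card_ord -/T.
move=> sumle; have := leq_trans sumle (leq_add sumT (leqnn _)).
have := leq_mul S4 (leqnn b); have : 0 < b * T by rewrite muln_gt0 b0.
by move: #|S| => s; lia.
Qed.

Lemma size_flatten_ge (T : Type) b (cs : seq (seq T)) :
  all (fun c => b <= size c) cs -> b * size cs <= size (flatten cs).
Proof.
elim: cs => [|c cs IHcs] /=; first by rewrite muln0.
by case/andP => bc /IHcs; rewrite size_cat mulnS; apply: leq_add.
Qed.

Lemma disjoint_cycles_size (G : sgraph) (cs : seq (seq G)) b :
  disjoint_cycles cs -> all (fun c => b <= size c) cs -> b * size cs <= #|G|.
Proof.
move=> /disjoint_cycles_uniq /card_uniqP Ucs /size_flatten_ge.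
by move/leq_trans; apply; rewrite -Ucs max_card.
Qed.

Lemma disjoint_cycles_uniq_seq (G : sgraph) (cs : seq (seq G)) :
  disjoint_cycles cs -> uniq cs.
Proof.
rewrite /disjoint_cycles; elim: cs => //= c cs IHcs.
case/andP => /andP[/and3P[szc _ _] cycs] /andP[dis dcs].
rewrite IHcs ?cycs ?dcs // andbT; apply/negP => /(allP dis) /pred0P cc.
by case: c szc cc {dis} => // x c _ /(_ x); rewrite /= inE eqxx.
Qed.

Lemma count_cycles_of_size (G : sgraph) (cs : seq (seq G)) l :
  disjoint_cycles cs ->
  count (fun c => size c == l) cs <= #|[set c : l.-tuple G | is_cycle c]|.
Proof.
move=> dcs; pose s := pmap insub cs : seq (l.-tuple G).
have Us : uniq s by apply: pmap_sub_uniq; apply: disjoint_cycles_uniq_seq.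
have -> : count (fun c => size c == l) cs = size s by rewrite size_pmap_sub.
rewrite -(card_uniqP Us); apply/subset_leq_card/subsetP => c.
rewrite inE mem_pmap_sub; case/andP: dcs => cyc _; exact: (allP cyc).
Qed.

Lemma disjoint_cycles_filter (G : sgraph) (cs : seq (seq G)) a :
  disjoint_cycles cs -> disjoint_cycles (filter a cs).
Proof.
case/andP=> cyc dis; apply/andP; split; last exact: pairwise_filter.
by apply/allP => c; rewrite mem_filter => /andP[_ /(allP cyc)].
Qed.

Lemma count_short_cycles N m (f : {ffun 'I_m -> 'I_N * 'I_N}) M
    (cs : seq (seq (random_graph f))) :
  disjoint_cycles cs -> count (fun c => size c < M) cs <= short_cycles M f.
Proof.
move=> dcs; apply: leq_trans (_ : \sum_(l < M) count (fun c => size c == l) cs <= _).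
  elim: M => [|M IHM]; first by rewrite big_ord0 count_pred0.
  rewrite big_ord_recr /=; apply: leq_trans (leq_add IHM (leqnn _)).
  rewrite -count_predUI; apply: leq_trans (leq_addr _ _).
  by apply: sub_count => c /=; lia.
by apply: leq_sum => l _; apply: count_cycles_of_size.
Qed.

(** Short cycles are few altogether; long cycles are few when disjoint, because
    each of them uses at least [M] of the [N] vertices. *)
Lemma exists_expander_few_disjoint_cycles : exists2 q, 1 < q &
  forall N M, 0 < N -> exists G : sgraph, [/\ #|G| = N, expanding G &
    forall cs : seq (seq G), disjoint_cycles cs ->
      M * size cs <= M * (2 * q ^ M) + N].
Proof.
have [C gapC] := exists_gap_exponent; have C0 : 0 < C by case: C gapC.
exists (2 * C) => [|N M N0]; first by lia.
have [f [fAB fM]] := exists_sparse_expander M gapC N0.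
exists (random_graph f); split; first exact: card_ord.
  move=> A B dAB; rewrite card_ord => NA NB.
  have := fAB A B; rewrite /edgeless_pair NA NB /= => /forallPn[i].
  rewrite negbK; case fi : (f i) => [u v] /setXP[uA vB]; exists u, v; split=> //.
  rewrite /= /random_adj; apply/andP; split.
    by apply: contraTneq vB => <-; rewrite (disjointFr dAB).
  by apply/existsP; exists i; rewrite fi eqxx.
move=> cs dcs; rewrite -(count_predC (fun c => size c < M) cs) mulnDr leq_add //.
  rewrite leq_mul2l; apply/orP; right.
  exact: leq_trans (count_short_cycles M dcs) (ltnW fM).
rewrite -size_filter -[X in _ <= X](card_ord N).
apply: (disjoint_cycles_size (disjoint_cycles_filter _ dcs)).
by apply/allP => c; rewrite mem_filter /= -leqNgt => /andP[].
Qed.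

(** * The bound on disjoint cycles *)

(** A host expander on [12 * c.+1 * #|H|] vertices has treewidth above
    [c * #|H|], hence contains [H] as a minor, and its disjoint cycles are at
    least as many as those of [H]. The logarithm [M] to base [q ^ 2] makes
    [q ^ M] at most the square root of [#|H|], so that the short cycles of the
    host contribute less than the long ones. *)
Lemma few_disjoint_cycles (H : sgraph) (k c q : nat) (cs : seq (seq H)) :
  1 < q ->
  (forall N M, 0 < N -> exists G : sgraph, [/\ #|G| = N, expanding G &
    forall cs : seq (seq G), disjoint_cycles cs ->
      M * size cs <= M * (2 * q ^ M) + N]) ->
  bounds_excluded_treewidth H k -> 1 < #|H| -> k <= c * #|H| ->
  disjoint_cycles cs ->
  size cs * (trunc_log (q ^ 2) #|H|).+1 <= (24 * c.+1 + 4) * #|H|.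
Proof.
move=> q1 exG kH n1 kc dcs; set n := #|H| in n1 kc *; set M := trunc_log _ _.
have n0 : 0 < n := ltnW n1.
have cs_n : size cs <= n.
  rewrite -[size cs]mul1n; apply: disjoint_cycles_size => //.
  by apply/allP => d; case/andP: dcs => + _ => /allP cyc /cyc /and3P[/ltnW/ltnW].
(* when M = 0 the number of vertices is a sufficient bound *)
have [->|M0] := posnP M; first by rewrite muln1 (leq_trans cs_n) // leq_pmull.
have [|G [GN expG fewG]] := exG (12 * c.+1 * n) M; first by rewrite !muln_gt0.
have minorGH : has_minor G H.
  apply: contrapT => /kH kG; have := expanding_treewidth expG.
  by rewrite GN -mulnA leq_mul2l /= mulSn; lia.
have [cs' dcs' <-] := minor_disjoint_cycles minorGH dcs.
have := fewG cs' dcs'.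
have qM : q ^ M * q ^ M <= n.
  rewrite -expnMn mulnn; apply: trunc_logP => //.
  by rewrite -[1](exp1n 2) ltn_sqr.
have Mq : M <= q ^ M := ltnW (ltn_expl M q1).
have := leq_trans (leq_mul Mq (leqnn (q ^ M))) qM.
move: (size cs') (q ^ M) => s b h1 h2.
apply: leq_trans (_ : s * (2 * M) <= _); first by rewrite leq_mul2l; lia.
lia.
Qed.

Local Open Scope ring_scope.

Theorem proposition1p1 (R : realType) (c : R) (hc : 0 < c) :
  exists d : R, 0 < d /\
    forall H : sgraph, planar R H -> (2 <= #|H|)%N ->
    forall fH : nat, is_excluded_treewidth H fH ->
    fH%:R <= c * #|H|%:R ->
    forall cs : seq (seq H), disjoint_cycles cs ->
      (size cs)%:R <= d * #|H|%:R / ln (#|H|%:R : R).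
Proof.
have [q q1 exG] := exists_expander_few_disjoint_cycles.
pose c' := Num.bound c; have cc' : c < c'%:R by apply/archi_boundP/ltW.
have q2 : (1 < q ^ 2)%N by rewrite -[1%N](exp1n 2) ltn_sqr.
pose L : R := ln (q ^ 2)%:R.
have L0 : 0 < L by rewrite ln_gt0 // ltr1n.
exists ((24 * c'.+1 + 4)%:R * L); split; first by rewrite mulr_gt0.
move=> H _ n1 fH [fHP _] fHc cs dcs.
have fHc' : (fH <= c' * #|H|)%N.
  rewrite -(ler_nat R) natrM (le_trans fHc) // ler_wpM2r //; exact: ltW.
have n0 : (0 < #|H|)%N := ltnW n1.
have := few_disjoint_cycles q1 exG fHP n1 fHc' dcs.
set M := trunc_log _ _; rewrite -(ler_nat R) !natrM => bound.
have lnn : 0 < ln (#|H|%:R : R) by rewrite ln_gt0 // ltr1n.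
have lnnM : ln (#|H|%:R : R) <= M.+1%:R * L.
  rewrite /L mulr_natl -lnXn ?ltr0n ?(ltnW q2) // -natrX ler_ln ?posrE ?ltr0n //.
    by rewrite ler_nat ltnW // trunc_log_ltn.
  by rewrite expn_gt0 (ltnW q2).
rewrite ler_pdivlMr // (le_trans (ler_wpM2l _ lnnM)) // mulrA.
by rewrite [leRHS]mulrAC ler_pM2r.
Qed.
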